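(* Let $G$ be a finite group, and let $\mathcal{R}$ be a set of subgroups of $G$ containing exactly one representative of each conjugacy class of subgroups of $G$. Then the family of permutation characters $(\pi_H)_{H\in\mathcal{R}}$ is linearly independent over $\mathbb{C}$ (as functions $G\to\mathbb{C}$) if and only if $G$ is cyclic.
   Context: For a finite group $G$ and a subgroup $H\leq G$, $\pi_H=\operatorname{Ind}_H^G(1_H)\colon G\to\mathbb{C}$ denotes the permutation character of the action of $G$ by left multiplication on the set $G/H$ of left cosets of $H$; that is, $\pi_H(g)$ is the number of cosets $xH\in G/H$ with $gxH=xH$. *)

(* Defs.v *)
From HB Require Import structures.
From mathcomp Require Import all_boot all_order all_algebra all_fingroup all_solvable.
From mathcomp Require Import complex reals.

Set Implicit Arguments.
Unset Strict Implicit.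
Unset Printing Implicit Defensive.

Local Open Scope group_scope.

(* [lcoset X g] is the left translate gX; [lcosets H G] is the set of left
   cosets xH with x in G. *)
Definition fixed_cosets (gT : finGroupType) (G H : {group gT}) (g : gT) :
    {set {set gT}} :=
  [set X in lcosets H G | lcoset X g == X].

(* A function on G itself, not on the ambient type gT. The codomain is R[i]^o,
   i.e. R[i] as a vector space over itself, so that finite functions form a
   vector space over R[i] and [free] is linear independence over R[i]. *)
Definition perm_character (R : realType) (gT : finGroupType)
    (G H : {group gT}) : {ffun subg_of G -> R[i]^o} :=
  [ffun g => (#|fixed_cosets G H (sgval g)|%:R)%R].

(* 'JG is conjugation on {group gT}, so the orbits of G under it on the
   subgroups of G are the conjugacy classes of subgroups. *)
Definition conjugacy_representatives (gT : finGroupType) (G : {group gT})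
    (S : {set {group gT}}) : bool :=
  is_transversal S (orbit 'JG G @: subgroups G) (subgroups G).

(* Main.v *)
(** The value [pi_H g] only depends on the [G]-class of the cyclic group <[g]>,
    so the permutation characters lie in a space whose dimension is the number
    of classes of cyclic subgroups; independence thus forces every subgroup,
    [G] included, to be cyclic. Conversely, if [G] is cyclic then [pi_H]
    is nonzero at a generator of [K] exactly when [K] is contained in [H], so
    the values of the characters at generators form a triangular matrix with
    nonzero diagonal. *)
Require Import Defs.
From mathcomp Require Import all_boot all_order all_algebra all_fingroup all_solvable.
From mathcomp Require Import complex reals.

Set Implicit Arguments.
Unset Strict Implicit.
Unset Printing Implicit Defensive.

Import GRing.Theory Num.Theory.
Local Open Scope group_scope.

(** Since [g] fixes [x *: H] exactly when [g ^ x] lies in [H], the fixed cosets depend on [g] only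
    through [<[g]>]. *)
Lemma fixed_cosetsE (gT : finGroupType) (G H : {group gT}) (g : gT) :
  fixed_cosets G H g = [set x *: H | x in G & <[g]> :^ x \subset H].
Proof.
apply/setP=> X; rewrite inE.
have fixE x : (lcoset (x *: H) g == x *: H) = (<[g]> :^ x \subset H).
  rewrite lcosetE -cycleJ cycle_subG conjgE -lcosetM.
  rewrite (sameP eqP lcoset_eqP).
  by rewrite mem_lcoset !mulgA.
apply/andP/imsetP=> [[/lcosetsP[x Gx ->]] | [x]].
  by rewrite fixE => sKH; exists x; rewrite // inE Gx.
rewrite inE => /andP[Gx sKH] ->; rewrite fixE; split=> //.
by apply/lcosetsP; exists x.
Qed.

(** Left translation by [y^-1] carries the cosets fixed by [g] bijectively to those fixed by [h]. *)
Lemma card_fixed_cosets_conj (gT : finGroupType) (G H : {group gT})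
    (g h y : gT) : y \in G -> <[h]> = <[g]> :^ y ->
  #|fixed_cosets G H h| = #|fixed_cosets G H g|.
Proof.
move=> Gy def_h; rewrite !fixed_cosetsE def_h.
rewrite -[RHS](card_imset _ (@lcoset_inj _ y^-1)); congr #|pred_of_set _|.
apply/setP=> X; apply/imsetP/imsetP=> [[x] | [Y /imsetP[x]]].
  rewrite inE => /andP[Gx sH] ->; exists ((y * x) *: H).
    by apply/imsetP; exists (y * x); rewrite // inE groupM //= conjsgM.
  by rewrite -lcosetM mulKg.
rewrite inE => /andP[Gx sH] -> ->; exists (y^-1 * x).
  by rewrite inE groupM ?groupV //= -conjsgM mulKVg.
by rewrite lcosetM.
Qed.

(** Lets coefficients be indexed by the members of [A] instead of by positions in the
    enumeration. *)
Lemma free_enum (K : fieldType) (V : vectType K) (T : finType) (A : {set T})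
    (f : T -> V) :
  (forall a : T -> K, (\sum_(x in A) a x *: f x = 0)%R ->
     {in A, forall x, a x = 0%R}) ->
  free [seq f x | x <- enum A].
Proof.
move=> indep; apply/(@freeP _ _ _ (image_tuple f A)) => k sum0 i.
have Ai := enum_valP i.
rewrite -(enum_valK_in Ai i).
apply: (indep (fun x => k (enum_rank_in Ai x))) => //.
rewrite big_enum_val -[RHS]sum0; apply: eq_bigr => j _.
rewrite enum_valK_in; congr (_ *: _)%R.
by rewrite [RHS](nth_image 0%R f j).
Qed.

Lemma free_perm_character (R : realType) (gT : finGroupType) (G : {group gT})
    (S : {set {group gT}}) :
  cyclic G -> S \subset subgroups G ->
  free [seq perm_character R G H | H <- enum S].
Proof.
move=> cycG /subsetP sSG; apply: free_enum => a sum0.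
(* Downward induction on the order of [K]: the coefficients of larger subgroups vanish first. *)
suff a0 n K : K \in S -> #|G| - #|K| < n -> a K = 0%R.
  by move=> K SK; apply: (a0 _ K SK (ltnSn _)).
elim: n K => // n IHn K SK leKn.
have sKG: K \subset G by have:= sSG _ SK; rewrite inE.
have /cyclicP[g defK] := cyclicS sKG cycG.
have Gg: g \in G by rewrite (subsetP sKG) // defK cycle_id.
move/ffunP/(_ (subg G g)): sum0; rewrite sum_ffunE ffunE.
(* At a generator of [K], a term [H] other than [K] vanishes: by induction if [H] contains [K], and
   otherwise because [K], being normal in the abelian group [G], has no conjugate inside [H]. *)
rewrite (bigD1 K) //= big1 => [|H /andP[SH neqHK]]; last first.
  rewrite !ffunE subgK // fixed_cosetsE.
  have [sKH | nsKH] := boolP (K \subset H).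
    have ltKH: #|K| < #|H|.
      by rewrite proper_card // properEneq sKH andbT eq_sym.
    have sHG: H \subset G by have:= sSG _ SH; rewrite inE.
    rewrite (IHn H SH) ?scale0r //.
    rewrite -ltnS; apply: leq_trans leKn; rewrite ltnS ltn_sub2l //.
    exact: leq_trans ltKH (subset_leq_card sHG).
  rewrite (_ : [set _ | _ in _ & _] = set0) ?cards0 ?scaler0 //.
  apply/eqP; rewrite -subset0; apply/subsetP=> X /imsetP[x].
  rewrite inE => /andP[Gx]; rewrite -defK (normsP _ x Gx) ?(negPf nsKH) //.
  exact: sub_abelian_norm (cyclic_abelian cycG) sKG.
rewrite addr0 !ffunE subgK // => /eqP; rewrite mulf_eq0 pnatr_eq0.
(* The diagonal value is nonzero, since [g] fixes the coset [K] itself. *)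
case/orP=> [/eqP // |]; rewrite cards_eq0 => /eqP/setP/(_ (1 *: K)).
rewrite fixed_cosetsE inE => /imsetP[]; exists 1 => //.
by rewrite inE group1 /= conjsg1 defK.
Qed.

Lemma conjugacy_representativesP (gT : finGroupType) (G : {group gT})
    (S : {set {group gT}}) (K : {group gT}) :
  conjugacy_representatives G S -> K \subset G ->
  exists C, S :&: orbit 'JG G K = [set C].
Proof.
case/and3P=> _ _ /forall_inP repS sKG.
by apply/cards1P/repS/imset_f; rewrite inE.
Qed.

Lemma cyclic_of_free (R : realType) (gT : finGroupType) (G : {group gT})
    (S : {set {group gT}}) :
  conjugacy_representatives G S ->
  free [seq perm_character R G H | H <- enum S] -> cyclic G.
Proof.
move=> hS freeS.
(* [G] is alone in its conjugacy class, so it is its own representative. *)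
have SG: G \in S.
  have [C defC] := conjugacy_representativesP hS (subxx G).
  have: C \in S :&: orbit 'JG G G by rewrite defC set11.
  rewrite inE => /andP[SC /imsetP[x Gx defCx]].
  suff <-: C = G by [].
  by apply: val_inj; rewrite defCx /= conjGid.
pose Sc := [set C in S | cyclic C].
(* Indicator of the elements of [G] that generate a conjugate of [C]. *)
pose ind (C : {group gT}) : {ffun subg_of G -> R[i]^o} :=
  [ffun g => ((C \in orbit 'JG G <[sgval g]>%G)%:R)%R].
have sub_span: (<<[seq perm_character R G H | H <- enum S]>>
                  <= <<[seq ind C | C <- enum Sc]>>)%VS.
  apply/span_subvP=> _ /mapP[H _ ->].
  (* The default [1] is never reached for [C] in [Sc], which is cyclic. *)
  pose gen (C : {group gT}) := odflt 1 [pick x in C | generator C x].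
  have -> : perm_character R G H =
     (\sum_(C in Sc) (#|fixed_cosets G H (gen C)|%:R : R[i]) *: ind C)%R.
    apply/ffunP=> g; rewrite sum_ffunE.
    have Gg: <[sgval g]> \subset G by rewrite cycle_subG subgP.
    have [C defC] := @conjugacy_representativesP _ _ _ <[sgval g]>%G hS Gg.
    have: C \in S :&: orbit 'JG G <[sgval g]>%G by rewrite defC set11.
    rewrite inE => /andP[SC gC]; have /imsetP[x Gx defCx] := gC.
    have defCg : C = <[sgval g]> :^ x :> {set gT} by rewrite defCx.
    have cycC: cyclic C by rewrite defCg cyclicJ cycle_cyclic.
    have genC: C = <[gen C]> :> {set gT}.
      rewrite /gen; case: pickP => [y /andP[_ /eqP] // | nogen].
      have /cyclicP[y defy] := cycC.
      have:= nogen y; rewrite /generator defy eqxx andbT.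
      by rewrite cycle_id.
    (* At [g], only the representative [C] of the class of [<[g]>] contributes. *)
    rewrite (bigD1 C) /=; last by rewrite inE SC.
    rewrite big1 => [|D /andP[]]; last first.
      rewrite inE => /andP[SD _] neqDC; rewrite !ffunE.
      have:= in_set1 D C; rewrite -defC inE SD (negPf neqDC) /= => ->.
      by rewrite scaler0.
    rewrite addr0 !ffunE gC [RHS]mulr1.
    by rewrite (@card_fixed_cosets_conj _ G H (sgval g) (gen C) x) // -genC.
  apply: memv_suml => C ScC; apply/memvZ/memv_span/map_f.
  by rewrite mem_enum.
(* Freeness makes [#|S|] the dimension of a space spanned inside that of [#|Sc|] indicators. *)
have leSc: #|S| <= #|Sc|.
  have:= leq_trans (dimvS sub_span) (dim_span _).
  by rewrite (eqP freeS) !size_map -!cardE.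
have /eqP defSc: Sc == S.
  by rewrite eqEcard leSc andbT; apply/subsetP=> C; rewrite inE => /andP[].
by move: SG; rewrite -defSc inE => /andP[].
Qed.

Theorem mainTheorem1 (R : realType) (gT : finGroupType) (G : {group gT})
    (S : {set {group gT}}) (hS : conjugacy_representatives G S) :
  free [seq perm_character R G H | H <- enum S] <-> cyclic G.
Proof.
split=> [|cycG]; first exact: cyclic_of_free.
by apply: free_perm_character => //; have /and3P[] := hS.
Qed.
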